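(* Let $M=M[U,L]$ be a lattice path matroid of rank $r$ on $r+m$ elements. Then the matroid basis polytope $P_M$ equals the set $\mathcal{C}_M$ of step vectors of all generalized lattice paths of $M$.
   Context: A lattice path from $(0,0)$ to $(m,r)$ is a path using unit steps $(1,0)$ and $(0,1)$; its step vector is $\mathrm{st}(P)=(P_1,\dots,P_{r+m})\in\{0,1\}^{r+m}$, where $P_i$ is the $y$-coordinate change of the $i$-th step. For lattice paths $U,L$ from $(0,0)$ to $(m,r)$ with $L$ never going above $U$, the lattice path matroid $M[U,L]$ is the matroid on $\{1,\dots,r+m\}$ whose bases are the sets $\{i: P_i=1\}$ for all lattice paths $P$ from $(0,0)$ to $(m,r)$ that never go above $U$ and never go below $L$. The matroid basis polytope is $P_M=\mathrm{conv}\{\sum_{i\in B}e_i : B \text{ a basis of } M\}\subseteq\mathbb{R}^{r+m}$. Let $R(M)$ be the closed region of the plane bounded by $U$ and $L$, let $l_i$ be the line $x+y=i$, and $T_i=l_i\cap R(M)$ for $i=0,\dots,r+m$. A generalized lattice path $P$ of $M$ is a polygonal path with bend points $(x_0,y_0),\dots,(x_{r+m},y_{r+m})$, where $(x_i,y_i)\in T_i$ for each $i$, and $x_i\le x_{i+1}$, $y_i\le y_{i+1}$ for $i=0,\dots,r+m-1$; its step vector is $\mathrm{st}(P)$ with $i$-th entry $y_i-y_{i-1}$. *)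

(* Defs.v *)
From HB Require Import structures.
From mathcomp Require Import all_boot all_order all_algebra.
From mathcomp Require Import zify.
From mathcomp Require Import classical_sets reals convex.

Set Implicit Arguments.
Unset Strict Implicit.
Unset Printing Implicit Defensive.

Import Order.TTheory GRing.Theory Num.Theory.

Record matroid (T : finType) := Matroid {
  bases : {set {set T}};
  bases_neq0 : exists B, B \in bases;
  bases_exchange : forall A B, A \in bases -> B \in bases ->
    forall a, a \in A :\: B ->
      exists2 b, b \in B :\: A & b |: (A :\ a) \in bases }.

Section Words.
Variable n : nat.
Implicit Types s : {ffun 'I_n -> bool}.

(* The path with step vector s (true is a (0,1) step, false a (1,0) step) is,
   after its first k steps, at the point (xpos s k, ypos s k); for k >= n this
   is its endpoint. Steps are indexed from 0. *)
Definition xpos s (k : nat) : nat := \sum_(i < n | i < k) ~~ s i.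
Definition ypos s (k : nat) : nat := \sum_(i < n | i < k) s i.

Lemma ypos0 s : ypos s 0 = 0.
Proof. by rewrite /ypos big_pred0. Qed.

Lemma yposS s (i : 'I_n) : ypos s i.+1 = ypos s i + s i.
Proof.
rewrite /ypos (bigD1 i) //= addnC; congr (_ + _); apply: eq_bigl => j.
by rewrite ltnS ltn_neqAle andbC; congr (_ && _).
Qed.

Lemma yposE s : ypos s n = #|[set i | s i]|.
Proof.
rewrite /ypos -sum1_card [RHS]big_mkcond /=.
by apply: eq_big => [i|i _]; rewrite ?ltn_ord // inE; case: (s i).
Qed.

Lemma xpos_ypos s : xpos s n + ypos s n = n.
Proof.
rewrite /xpos /ypos -big_split /= -[RHS]card_ord -sum1_card.
by apply: eq_big => [i|i _]; rewrite ?ltn_ord //; case: (s i).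
Qed.

Lemma ypos_swap s (a b : 'I_n) k : s a -> ~~ s b ->
  ypos [ffun i => (i == b) || (i != a) && s i] k + (a < k)
  = ypos s k + (b < k).
Proof.
move=> sa sb; have ab : a != b by apply: contraNneq sb => <-.
rewrite /ypos; under eq_bigr do rewrite ffunE.
rewrite !(big_mkcond (fun i : 'I_n => i < k)) /=.
have D F : \sum_i F i = F a + (F b + \sum_(i | (i != a) && (i != b)) F i) :> nat.
  by rewrite (bigD1 a) //= [X in _ + X](bigD1 b) //= eq_sym.
rewrite !D !eqxx (negPf ab) (negPf sb) sa /=.
under eq_bigr => i /andP[ia ib] do rewrite (negPf ib) ia /=.
by case: (a < k); case: (b < k); lia.
Qed.

End Words.

Record lattice_path (m r : nat) := LatticePath {
  steps :> {ffun 'I_(r + m) -> bool};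
  steps_end :
    (xpos steps (r + m) == m) && (ypos steps (r + m) == r) }.

HB.instance Definition _ m r := [isSub for @steps m r].
HB.instance Definition _ m r := [Finite of lattice_path m r by <:].

Section LatticePathMatroid.
Variables m r : nat.
Implicit Types P Q U L : lattice_path m r.

(* All lattice paths meet the line x + y = k in exactly one point, the one
   reached after k steps, so paths are compared by their heights there. *)
Definition never_above P Q : bool :=
  [forall k : 'I_(r + m).+1, ypos P k <= ypos Q k].

Definition never_below P Q : bool := never_above Q P.

Lemma never_aboveP P Q :
  reflect (forall k, k <= r + m -> ypos P k <= ypos Q k) (never_above P Q).
Proof.
apply: (iffP forallP) => [PQ k|PQ k]; last by apply: PQ; rewrite -ltnS.
by rewrite -ltnS => kn; have := PQ (Ordinal kn).
Qed.

Definition step_set P : {set 'I_(r + m)} := [set i | P i].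

Definition lpm_bases U L : {set {set 'I_(r + m)}} :=
  [set step_set P | P : lattice_path m r & never_above P U && never_below P L].

Lemma card_lpm_bases U L B : B \in lpm_bases U L -> #|B| = r.
Proof.
case/imsetP => P _ ->; rewrite -yposE.
by have /andP[_ /eqP] := steps_end P.
Qed.

Lemma lpm_bases_neq0 U L : never_above L U -> exists B, B \in lpm_bases U L.
Proof.
move=> LU; exists (step_set U); apply: imset_f; rewrite inE /never_below LU.
by rewrite andbT; apply/never_aboveP.
Qed.

Lemma lpm_bases_exchange U L A B :
  A \in lpm_bases U L -> B \in lpm_bases U L -> forall a, a \in A :\: B ->
  exists2 b, b \in B :\: A & b |: (A :\ a) \in lpm_bases U L.
Proof.
case/imsetP => P /[!inE] /andP[/never_aboveP PU /never_aboveP PL] ->.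
case/imsetP => Q /[!inE] /andP[/never_aboveP QU /never_aboveP QL] -> a.
rewrite !inE => /andP[nQa Pa].
have /andP[_ /eqP Pr] := steps_end P; have /andP[_ /eqP Qr] := steps_end Q.
have Pa1 := yposS P a; have Qa1 := yposS Q a.
rewrite Pa in Pa1; rewrite (negPf nQa) in Qa1.
suff [b [nPb Qb bU bL]] : exists b : 'I_(r + m), [/\ ~~ P b, Q b,
    forall k, k <= r + m -> ypos P k + (b < k) <= ypos U k + (a < k) &
    forall k, k <= r + m -> ypos L k + (a < k) <= ypos P k + (b < k)].
  exists b; first by rewrite !inE Qb nPb.
  pose s := [ffun i => (i == b) || (i != a) && P i].
  have sE k : ypos s k + (a < k) = ypos P k + (b < k) by exact: ypos_swap.
  have sr : (xpos s (r + m) == m) && (ypos s (r + m) == r).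
    have := sE (r + m); have := xpos_ypos s.
    by rewrite !ltn_ord Pr; lia.
  apply/imsetP; exists (LatticePath sr).
    rewrite inE; apply/andP; split; apply/never_aboveP => k kn /=.
      by have := bU k kn; rewrite -sE leq_add2r.
    by have := bL k kn; rewrite -sE leq_add2r.
  by apply/setP => i; rewrite !inE ffunE.
have [QPa|PQa] := ltnP (ypos Q a.+1) (ypos P a.+1).
  have ex : exists k, (a < k) && (ypos P k <= ypos Q k).
    by exists (r + m); rewrite ltn_ord Pr Qr leqnn.
  case: (ex_minnP ex) => [[//|k]] /andP[ak PQk] kmin.
  have kn : k < r + m by apply: kmin; rewrite ltn_ord Pr Qr leqnn.
  have lt i : a < i -> i <= k -> ypos Q i < ypos P i.
    move=> ai ik; rewrite ltnNge; apply/negP => PQi.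
    by have := kmin i; rewrite ai PQi => /(_ isT); lia.
  have ak' : a < k.
    rewrite ltn_neqAle -ltnS ak andbT; apply/eqP => eak.
    by move: PQk; rewrite -eak; lia.
  have := lt k ak' (leqnn k).
  have := yposS P (Ordinal kn); have := yposS Q (Ordinal kn) => /= QS PS ltk.
  exists (Ordinal kn); split => /=.
  - by case: (P _) PS => //; case: (Q _) QS; lia.
  - by case: (Q _) QS => //; case: (P _) PS; lia.
  - by move=> i /PU; case: (ltnP k i); case: (ltnP a i); lia.
  - move=> i /[dup] /PL PLi /QL QLi.
    have := lt i; case: (ltnP k i) => ki; case: (ltnP a i) => ai; lia.
have ex : exists k, (k <= a) && (ypos Q k <= ypos P k).
  by exists 0; rewrite !ypos0.
have bnd k : (k <= a) && (ypos Q k <= ypos P k) -> k <= a by case/andP.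
case: (ex_maxnP ex bnd) => k /andP[ka QPk] kmax.
have lt i : k < i -> i <= a -> ypos P i < ypos Q i.
  move=> ki ia; rewrite ltnNge; apply/negP => QPi.
  by have := kmax i; rewrite ia QPi => /(_ isT); lia.
have ka' : k < a.
  by rewrite ltn_neqAle ka andbT; apply/eqP => eka; move: QPk; rewrite eka; lia.
have kn : k < r + m by apply: ltn_trans (ltn_ord a).
have := lt k.+1 (leqnn _) ka'.
have := yposS P (Ordinal kn); have := yposS Q (Ordinal kn) => /= QS PS ltk.
exists (Ordinal kn); split => /=.
- by case: (P _) PS => //; case: (Q _) QS; lia.
- by case: (Q _) QS => //; case: (P _) PS; lia.
- move=> i /[dup] /PU PUi /QU QUi.
  have := lt i; case: (ltnP k i) => ki; case: (ltnP a i) => ai; lia.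
- by move=> i /PL; case: (ltnP k i); case: (ltnP a i); lia.
Qed.

Definition lpm U L (LU : never_above L U) : matroid 'I_(r + m) :=
  Matroid (lpm_bases_neq0 LU) (@lpm_bases_exchange U L).

End LatticePathMatroid.

Local Open Scope classical_set_scope.
Local Open Scope ring_scope.

Definition convex_hull (R : realType) (V : lmodType R) (A : set V) : set V :=
  smallest (@convex_set R V) A.

Definition basis_polytope (R : realType) (n : nat) (M : matroid 'I_n) :
    set 'rV[R]_n :=
  convex_hull [set v | exists2 B, B \in bases M &
                       v = \sum_(i in B) delta_mx 0 i].

Section GeneralizedLatticePaths.
Variables (R : realType) (m r : nat).
Implicit Types (U L P : lattice_path m r) (p : 'I_(r + m).+1 -> R * R).

(* The union of the segments joining consecutive lattice points of P. The
   segment for k = r + m is the endpoint alone, so that the curve is nonempty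
   even if r + m = 0. *)
Definition curve P : set (R * R) :=
  [set q | exists k t, [/\ (k <= r + m)%N, 0 <= t <= 1,
    q.1 = (1 - t) * (xpos P k)%:R + t * (xpos P k.+1)%:R &
    q.2 = (1 - t) * (ypos P k)%:R + t * (ypos P k.+1)%:R]].

(* The points lying weakly above a point of L and weakly below a point of U on
   the same vertical line. *)
Definition region U L : set (R * R) :=
  [set q | exists y1 y2,
    [/\ curve L (q.1, y1), curve U (q.1, y2) & y1 <= q.2 <= y2]].

Definition diagonal (i : nat) : set (R * R) := [set q | q.1 + q.2 = i%:R].

Definition diagonal_slice U L (i : nat) : set (R * R) := diagonal i `&` region U L.

(* For i : 'I_(r + m), lift ord_max i and lift ord0 i are the indices i and
   i + 1 in 'I_(r + m).+1. *)
Definition gen_lattice_path U L p : Prop :=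
  (forall i : 'I_(r + m).+1, diagonal_slice U L i (p i)) /\
  (forall i : 'I_(r + m),
    (p (lift ord_max i)).1 <= (p (lift ord0 i)).1 /\
    (p (lift ord_max i)).2 <= (p (lift ord0 i)).2).

Definition step_vector p : 'rV[R]_(r + m) :=
  \row_i ((p (lift ord0 i)).2 - (p (lift ord_max i)).2).

Definition gen_step_vectors U L : set 'rV[R]_(r + m) :=
  [set step_vector p | p in gen_lattice_path U L].

End GeneralizedLatticePaths.

(* Main.v *)
(* Step vectors of generalized lattice paths are described by heights h_k with
   0 <= h_(k+1) - h_k <= 1 and ypos L k <= h_k <= ypos U k, and these
   conditions are convex. Conversely, for theta in ]0, 1] the heights
   floor (h_k + 1 - theta) are those of a lattice path between L and U, and
   averaging over theta recovers h. The average is a finite sum since only the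
   fractional parts of the h_k matter as thresholds. *)
Require Import Defs.
From mathcomp Require Import all_boot all_order all_algebra.
From mathcomp Require Import zify ring lra.
From mathcomp Require Import interval_inference.
From mathcomp Require Import classical_sets reals convex.

Set Implicit Arguments.
Unset Strict Implicit.
Unset Printing Implicit Defensive.

Import Order.TTheory GRing.Theory Num.Theory.

Local Open Scope classical_set_scope.
Local Open Scope ring_scope.

(** * Finite convex combinations *)

Section Convexity.
Variables (R : realType) (V : lmodType R).
Implicit Types (C : set V) (x y : V).

Lemma convex_setP C :
  convex_set (C : set (convex_lmodType V)) <->
  forall x y (t : R), 0 <= t <= 1 -> C x -> C y -> C (t *: x + (1 - t) *: y).
Proof.
split=> [cC x y t /andP[t0 t1] Cx Cy|cC x y t /set_mem Cx /set_mem Cy].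
  exact/set_mem/(cC x y (Itv01 t0 t1))/mem_set/Cy/mem_set.
by apply/mem_set/cC => //; rewrite ge0 le1.
Qed.

(** By induction each sum is its total weight times a point of [C], which avoids normalising the
    tail; if the total weight is 0, any point of [C] will do. *)
Lemma convex_sum (I : eqType) (l : seq I) C (w : I -> R) (f : I -> V) :
  convex_set (C : set (convex_lmodType V)) ->
  (forall i, i \in l -> 0 <= w i) -> (forall i, i \in l -> C (f i)) ->
  \sum_(i <- l) w i = 1 -> C (\sum_(i <- l) w i *: f i).
Proof.
move=> /convex_setP cC w0 Cf w1.
have [x0 Cx0] : exists x, C x.
  case: l w1 Cf {w0} => [|i l _ Cf]; last by exists (f i); apply/Cf/mem_head.
  by rewrite big_nil => /eqP; rewrite eq_sym oner_eq0.
suff [z Cz] : exists2 z, C z &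
    \sum_(i <- l) w i *: f i = (\sum_(i <- l) w i) *: z.
  by rewrite w1 scale1r => ->.
elim: l w0 Cf {w1} => [|i l IH] w0 Cf.
  by exists x0; rewrite // !big_nil scale0r.
have [j jl|j jl|z Cz IHz] := IH; first by rewrite w0// inE jl orbT.
  by apply: Cf; rewrite inE jl orbT.
have wi0 : 0 <= w i by rewrite w0 ?mem_head.
have W0 : 0 <= \sum_(j <- l) w j.
  by rewrite big_seq sumr_ge0// => j jl; rewrite w0// inE jl orbT.
rewrite !big_cons IHz; set W := \sum_(j <- l) w j in W0 *.
have [S0|S0] := eqVneq (w i + W) 0.
  exists x0 => //; move/eqP: S0; rewrite paddr_eq0// => /andP[/eqP-> /eqP->].
  by rewrite addr0 !scale0r addr0.
have Sgt0 : 0 < w i + W by rewrite lt_def S0 addr_ge0.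
exists (w i / (w i + W) *: f i + (1 - w i / (w i + W)) *: z).
  apply: cC => //; last by apply/Cf/mem_head.
  by rewrite ler_pdivrMr// mul1r lerDl W0 divr_ge0// ltW.
rewrite scalerDr !scalerA; congr (_ *: _ + _ *: _); field; exact: S0.
Qed.

End Convexity.

(** * Averages of threshold indicators *)

Section LayerCake.
Variable R : realDomainType.
Implicit Types (x c : R) (s : seq R).

(** Lengths and right endpoints of consecutive intervals: if [c] is not strictly between [x] and
    [y], the truth of [theta <= c] is constant on ]x, y], so [y] represents the interval. *)
Fixpoint gaps x s : seq (R * R) :=
  if s is y :: s' then (y - x, y) :: gaps y s' else [::].

Lemma mem_gaps x s p : path <=%R x s -> p \in gaps x s ->
  0 <= p.1 /\ p.2 \in s.
Proof.
elim: s x => //= y s IH x /andP[xy ys]; rewrite !inE => /predU1P[->|/IH] /=.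
  by rewrite subr_ge0 xy eqxx.
by case/(_ ys) => -> ->; rewrite orbT.
Qed.

(** A nonzero indicator forces [y <= c <= x <= y], a gap of length 0. *)
Lemma sum_gaps_eq0 x s c : path <=%R x s -> c <= x ->
  \sum_(p <- gaps x s) p.1 * (p.2 <= c)%R%:R = 0.
Proof.
elim: s x => [|y s IH] x /=; first by rewrite big_nil.
case/andP=> xy ys cx; rewrite big_cons /= IH ?(le_trans cx)// addr0.
case: leP => [yc|]; last by rewrite mulr0.
by rewrite [y](@le_anti _ _ y x) ?subrr ?mul0r ?xy ?(le_trans yc).
Qed.

(** Gaps up to [c] telescope; later ones contribute 0. *)
Lemma sum_gaps x s c : path <=%R x s -> c \in x :: s ->
  \sum_(p <- gaps x s) p.1 * (p.2 <= c)%R%:R = c - x.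
Proof.
elim: s x => [|y s IH] x.
  by rewrite inE big_nil => _ /eqP->; rewrite subrr.
move=> pxys; rewrite inE => /predU1P[->|cys].
  by rewrite sum_gaps_eq0 ?subrr.
case/andP: pxys => xy ys; rewrite big_cons /= IH//.
have -> : y <= c.
  move: cys; rewrite inE => /predU1P[->//|].
  exact/allP/(order_path_min le_trans ys).
by rewrite mulr1 addrC subrKA.
Qed.

(* The value c is recovered by averaging the indicators of [theta <= c] over
   theta in ]0, 1]; for finitely many c this average is a finite sum. *)
Lemma layer_cake s : (forall c, c \in s -> 0 <= c <= 1) ->
  exists l : seq (R * R),
    [/\ forall p, p \in l -> 0 <= p.1 /\ 0 < p.2 <= 1,
        \sum_(p <- l) p.1 = 1 &
        forall c, c \in s -> \sum_(p <- l) p.1 * (p.2 <= c)%R%:R = c].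
Proof.
(* Including 1 makes the weights sum to 1; zeros are dropped to keep thresholds positive and are
   covered by the starting point 0 of [gaps]. *)
move=> s01; pose s' := sort <=%R (1 :: [seq c <- s | 0 < c]).
have s'P c : c \in s' -> 0 < c <= 1.
  rewrite mem_sort inE mem_filter => /predU1P[->|]; first by rewrite ltr01 lexx.
  by case/andP=> c0 /s01/andP[_ ->]; rewrite c0.
have ps' : path <=%R 0 s'.
  rewrite path_min_sorted ?sort_sorted//; first exact: le_total.
  by apply/allP => c /s'P/andP[/ltW].
exists (gaps 0 s'); split.
- by move=> p /(mem_gaps ps')[p0 /s'P].
- have <- := subr0 (1 : R).
  rewrite -(sum_gaps ps' _); last by rewrite inE mem_sort mem_head orbT.
  apply: eq_big_seq => p /(mem_gaps ps')[_ /s'P/andP[_ ->]].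
  by rewrite mulr1.
move=> c cs; rewrite sum_gaps ?subr0// inE mem_sort inE mem_filter cs andbT.
have /andP[] := s01 _ cs.
by rewrite le_eqVlt eq_sym => /orP[] ->; rewrite ?orbT.
Qed.

End LayerCake.

(** * Coordinates of lattice points on a path *)

Section Positions.
Variable n : nat.
Implicit Types s : {ffun 'I_n -> bool}.

Lemma pos_sum s k : (k <= n)%N -> (xpos s k + ypos s k = k)%N.
Proof.
move=> kn; rewrite /xpos /ypos -big_split /=.
rewrite (eq_bigr (fun=> 1%N)) => [|i _]; last by case: (s i).
by rewrite -[RHS](card_ord k) -[RHS]sum1_card (big_ord_widen n (fun=> 1%N) kn).
Qed.

Lemma xpos_le s j k : (j <= k)%N -> (xpos s j <= xpos s k)%N.
Proof.
move=> jk; rewrite /xpos big_mkcond [leqRHS]big_mkcond leq_sum// => i _.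
by case: ltnP => // /leq_trans->.
Qed.

(** Handles the index [k.+1] past the end in the last, degenerate segment of [curve]. *)
Lemma pos_end s j k : (n <= j)%N -> (n <= k)%N ->
  xpos s j = xpos s k /\ ypos s j = ypos s k.
Proof.
move=> nj nk; split; apply: eq_bigl => i; rewrite !(leq_trans (ltn_ord i))//.
Qed.

End Positions.

(** * The region along the diagonals *)

Section Slices.
Variables (R : realType) (m r : nat).
Implicit Types (U L P : lattice_path m r) (q : R * R).

(** Each step raises x + y by 1, so x + y parametrises the curve. *)
Lemma curve_sum P q : curve P q -> exists k t,
  [/\ 0 <= t <= 1, q.1 = (1 - t) * (xpos P k)%:R + t * (xpos P k.+1)%:R &
      q.1 + q.2 = k%:R + t].
Proof.
case=> k [t [kn t01 q1 q2]]; have := pos_sum P kn.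
move=> /(congr1 (fun j => j%:R : R)); rewrite natrD => sk.
(* The segment at [k = r + m] is a single point, so its parameter is reset to 0. *)
move: (kn); rewrite leq_eqVlt => /predU1P[ekn|ltkn].
  have [||ex ey] := @pos_end _ P k.+1 k; [lia|lia|exists k, 0].
  by rewrite q1 q2 ex ey lexx ler01; split=> //; lra.
have := pos_sum P ltkn.
move=> /(congr1 (fun j => j%:R : R)); rewrite natrD -natr1 => sk1.
exists k, t; split=> //; rewrite q1 q2 addrACA -!mulrDr sk sk1; ring.
Qed.

(** Along the curve x is nondecreasing in x + y, and diagonal [i] is met after [i] steps. *)
Lemma xpos_le_curve P q i : curve P q ->
  i%:R <= q.1 + q.2 -> (xpos P i)%:R <= q.1.
Proof.
move=> /curve_sum[k [t [/andP[t0 t1] -> ->]]] ikt.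
have : (xpos P k <= xpos P k.+1)%N by rewrite xpos_le.
rewrite -(ler_nat R) => xk; have [ik|ki] := leqP i k.
  have : (xpos P i <= xpos P k)%N by rewrite xpos_le.
  by rewrite -(ler_nat R); nra.
move: ki ikt; rewrite leq_eqVlt => /predU1P[<-|]; rewrite -?(ltr_nat R) -?natr1.
  by move=> kt; have -> : t = 1 by [lra]; lra.
by lra.
Qed.

Lemma curve_le_xpos P q i : curve P q ->
  q.1 + q.2 <= i%:R -> q.1 <= (xpos P i)%:R.
Proof.
move=> /curve_sum[k [t [/andP[t0 t1] -> ->]]] ikt.
have : (xpos P k <= xpos P k.+1)%N by rewrite xpos_le.
rewrite -(ler_nat R) => xk; have [ki|ik] := ltnP k i.
  have : (xpos P k.+1 <= xpos P i)%N by rewrite xpos_le.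
  by rewrite -(ler_nat R); nra.
move: ik ikt; rewrite leq_eqVlt => /predU1P[->|]; rewrite -?(ltr_nat R).
  by move=> kt; have -> : t = 0 by [lra]; lra.
by lra.
Qed.

(** A discrete intermediate value argument: either [x] is reached within [j] steps or it lies on the
    last one. *)
Lemma curve_at P (x : R) i j : (i <= j <= r + m)%N ->
  (xpos P i)%:R <= x <= (xpos P j)%:R ->
  exists2 y, curve P (x, y) & i%:R <= x + y <= j%:R.
Proof.
elim: j => [|j IH] /andP[].
  rewrite leqn0 => /eqP-> _ /le_anti <-; exists (ypos P 0)%:R.
    by exists 0%N, 0; rewrite lexx ler01 subr0 !mul1r !mul0r !addr0.
  by rewrite -natrD pos_sum// lexx.
rewrite leq_eqVlt => /predU1P[-> jn /le_anti <-|ij jn /andP[ix xj]].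
  exists (ypos P j.+1)%:R; last by rewrite -natrD pos_sum// lexx.
  by exists j.+1, 0; rewrite lexx ler01 subr0 !mul1r !mul0r !addr0.
have [xj'|jx] := leP x (xpos P j)%:R.
  have [||y Py /andP[iy yj]] := IH; rewrite ?ix ?xj'//; first by lia.
  by exists y; rewrite // iy (le_trans yj)// ler_nat.
have yS := yposS P (Ordinal jn); have pj := pos_sum P (ltnW jn).
have pj1 := pos_sum P jn; rewrite /= in yS.
(* Since [x] exceeds [xpos P j], this step is horizontal and contains the point sought. *)
have : (xpos P j < xpos P j.+1)%N by rewrite -(ltr_nat R); lra.
move=> xlt; have xE : xpos P j.+1 = (xpos P j).+1 by case: (P _) yS => /=; lia.
have yE : ypos P j.+1 = ypos P j by lia.
move/(congr1 (fun j => j%:R : R)): pj; rewrite natrD => pj.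
rewrite xE -natr1 in xj; exists (ypos P j)%:R.
  exists j, (x - (xpos P j)%:R); rewrite xE yE -natr1 /=.
  by split; [exact: ltnW|lra|ring|ring].
move: ij; rewrite ltnS -(ler_nat R) -natr1; lra.
Qed.

(* The region compares a point with U and L along a vertical line. As lattice
   paths go up and right, comparing along x + y = i instead is equivalent. *)
Lemma diagonal_sliceP U L i q : (i <= r + m)%N ->
  diagonal_slice U L i q <->
  q.1 + q.2 = i%:R /\ (ypos L i)%:R <= q.2 <= (ypos U i)%:R.
Proof.
move=> iN; have XY P : (xpos P i)%:R + (ypos P i)%:R = i%:R :> R.
  by rewrite -natrD pos_sum.
have := XY U; have := XY L; case: q => x y XYL XYU; split=> /=.
  case; rewrite /Defs.diagonal /= => xyi.
  move=> [y1 [y2 [/= Ly1 Uy2]]] /= /andP[y1y yy2].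
  have xL : x <= (xpos L i)%:R by apply: curve_le_xpos Ly1 _ => /=; lra.
  have xU : (xpos U i)%:R <= x by apply: xpos_le_curve Uy2 _ => /=; lra.
  by split=> //; lra.
case=> xyi /andP[Ly yU]; split=> //.
have xm P : (xpos P i <= xpos P (r + m))%N by rewrite xpos_le.
have xE P : xpos P (r + m) = m by case: P => s /= /andP[/eqP].
have := xm L; have := xm U; rewrite !xE -!(ler_nat R) => xmU xmL.
(* Searching [U] from step [i] on gives a height at least [i - x = y]; searching [L] up to step [i]
   gives one at most [y]. *)
have [||y2 Uy2 /andP[iy2 _]] := @curve_at U x i (r + m).
- by rewrite iN leqnn.
- by rewrite xE; lra.
have [||y1 Ly1 /andP[_ y1i]] := @curve_at L x 0 i; first by rewrite iN.
  have -> : xpos L 0 = 0%N by rewrite /xpos big_pred0.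
  by have := ler0n R (xpos U i); lra.
by exists y1, y2; split=> //=; lra.
Qed.

End Slices.

(** * Rounding heights to lattice paths *)

Section Rounding.
Variables (R : realType) (m r : nat) (U L : lattice_path m r).
Implicit Types p : 'I_(r + m).+1 -> R * R.

Lemma basis_vectorE (P : lattice_path m r) :
  \sum_(i in step_set P) delta_mx 0 i = \row_i (P i)%:R :> 'rV[R]_(r + m).
Proof.
rewrite [RHS]row_sum_delta [LHS]big_mkcond; apply: eq_bigr => i _.
by rewrite inE mxE; case: (P i); rewrite ?scale1r ?scale0r.
Qed.

(** As [0 <= 1 - theta < 1], rounding preserves integral bounds; being monotone and compatible with
    adding 1, it yields increments 0 or 1. *)
Lemma rounded_path (h : nat -> R) (theta : R) : 0 < theta <= 1 ->
  (forall k, (k <= r + m)%N -> (ypos L k)%:R <= h k <= (ypos U k)%:R) ->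
  (forall k, (k < r + m)%N -> h k <= h k.+1 <= h k + 1) ->
  exists P : lattice_path m r, forall k, (k <= r + m)%N ->
    ypos P k = Num.truncn (h k + (1 - theta)) /\
    (ypos L k <= ypos P k <= ypos U k)%N.
Proof.
move=> /andP[th0 th1] hLU hstep; pose w k := Num.truncn (h k + (1 - theta)).
have wLU k : (k <= r + m)%N -> (ypos L k <= w k <= ypos U k)%N.
  move=> /hLU/andP[Lh hU]; have := ler0n R (ypos L k) => L0.
  by rewrite /w truncn_ge_nat ?truncn_le_nat -?natr1; lra.
have wS k : (k < r + m)%N -> (w k <= w k.+1 <= (w k).+1)%N.
  move=> /hstep/andP[h1 h2]; have := truncnS_gt (h k + (1 - theta)).
  rewrite -/(w k) -natr1 => wk.
  rewrite le_truncn ?lerD2r//= /w truncn_le_nat -!natr1 -/(w k); lra.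
pose s := [ffun i : 'I_(r + m) => w i != w i.+1].
have sw k : (k <= r + m)%N -> ypos s k = w k.
  elim: k => [_|k IH kn]; first by have := wLU 0%N isT; rewrite !ypos0; lia.
  have := yposS s (Ordinal kn); rewrite /= => ->; rewrite IH 1?ltnW// ffunE /=.
  by have := wS k kn; case: eqP; lia.
have yr (Q : lattice_path m r) : ypos Q (r + m) = r.
  by case: Q => ? /= /andP[_ /eqP].
(* [L] and [U] both end at height [r], which pins the last rounded height. *)
have s_end : (xpos s (r + m) == m) && (ypos s (r + m) == r).
  have := xpos_ypos s; have := wLU _ (leqnn (r + m)).
  by rewrite sw// !yr; lia.
by exists (LatticePath s_end) => k kn /=; rewrite sw// wLU.
Qed.

(** Adding [1 - theta] carries exactly when the fractional part reaches [theta]; this links rounding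
    to [layer_cake]. *)
Lemma truncn_round (x theta : R) : 0 <= x -> 0 < theta <= 1 ->
  Num.truncn (x + (1 - theta)) =
  (Num.truncn x + (theta <= x - (Num.truncn x)%:R)%R)%N.
Proof.
move=> /truncn_itv/andP[]; rewrite -natr1; set a := _%:R => ax xa /andP[t0 t1].
apply: truncn_def; rewrite -natr1 natrD -/a.
by case: (leP theta (x - a)) => ? /=; lra.
Qed.

(** Since x + y grows by 1 between diagonals, monotonicity of x becomes the upper bound on height
    increments. *)
Lemma gen_heights p : gen_lattice_path U L p ->
  (forall k : 'I_(r + m).+1, (ypos L k)%:R <= (p k).2 <= (ypos U k)%:R) /\
  (forall i : 'I_(r + m),
    (p (lift ord_max i)).2 <= (p (lift ord0 i)).2
      <= (p (lift ord_max i)).2 + 1).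
Proof.
move=> [slice_p mono_p].
have H k := (diagonal_sliceP U L (p k) (leq_ord k)).1 (slice_p k).
split=> [k|i]; first by have [] := H k.
have [x01 y01] := mono_p i; have [s0 _] := H (lift ord_max i).
have [s1 _] := H (lift ord0 i); move: s0 s1.
by rewrite lift_max lift0 -natr1; lra.
Qed.

(** The region need not be convex, but its diagonal slices are, so bend points can be averaged index
    by index. *)
Lemma convex_gen_step_vectors :
  convex_set (gen_step_vectors U L : set (convex_lmodType 'rV[R]_(r + m))).
Proof.
apply/convex_setP => _ _ t t01 [p [Sp Mp] <-] [q [Sq Mq] <-].
exists (fun k => (t * (p k).1 + (1 - t) * (q k).1,
                  t * (p k).2 + (1 - t) * (q k).2)).
  split=> i /=.
    have := Sp i; have := Sq i; rewrite !diagonal_sliceP ?leq_ord//=.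
    move=> [q1 /andP[Lq qU]] [p1 /andP[Lp pU]]; split; last by nra.
    have -> : (p i).1 = i%:R - (p i).2 by lra.
    have -> : (q i).1 = i%:R - (q i).2 by lra.
    by ring.
  by have [? ?] := Mp i; have [? ?] := Mq i; split; nra.
by apply/rowP => i; rewrite !mxE /=; ring.
Qed.

Lemma path_gen_step_vectors (P : lattice_path m r) :
  never_above P U -> never_below P L ->
  gen_step_vectors U L (\row_i (P i)%:R : 'rV[R]_(r + m)).
Proof.
move=> /never_aboveP PU /never_aboveP PL.
pose p (k : 'I_(r + m).+1) : R * R := ((xpos P k)%:R, (ypos P k)%:R).
have pE k : p k = ((xpos P k)%:R, (ypos P k)%:R) by [].
exists p.
  split=> i; rewrite !pE; first rewrite diagonal_sliceP ?leq_ord//=.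
    by rewrite -natrD pos_sum ?leq_ord// !ler_nat PL ?leq_ord// PU ?leq_ord.
  by rewrite lift_max lift0 yposS !ler_nat leq_addr xpos_le.
by apply/rowP => i; rewrite !mxE !pE lift_max lift0 yposS natrD addrC addKr.
Qed.

Lemma step_vector_in_convex (C : set 'rV[R]_(r + m)) p :
  convex_set (C : set (convex_lmodType 'rV[R]_(r + m))) ->
  (forall P : lattice_path m r, never_above P U -> never_below P L ->
    C (\row_i (P i)%:R)) ->
  gen_lattice_path U L p -> C (step_vector p).
Proof.
move=> cC CP /gen_heights[]; pose h k := (p (inord k)).2.
have hE k : (p k).2 = h k by rewrite /h inord_val.
move=> H1 H2.
have hLU k : (k <= r + m)%N -> (ypos L k)%:R <= h k <= (ypos U k)%:R.
  by move=> kn; have := H1 (inord k); rewrite inordK.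
have hS k : (k < r + m)%N -> h k <= h k.+1 <= h k + 1.
  by move=> kn; have := H2 (Ordinal kn); rewrite !hE lift_max lift0.
pose frac x : R := x - (Num.truncn x)%:R.
(* The fractional parts of all heights are treated at once, so that one family of weights serves
   every diagonal. *)
have [|l [lP l1 lsum]] :=
    @layer_cake R [seq frac (h k) | k : 'I_(r + m).+1 <- enum 'I_(r + m).+1].
  move=> _ /mapP[k _ ->]; have /andP[h0 _] := hLU k (leq_ord k).
  have /truncn_itv : 0 <= h k by apply: le_trans h0.
  by rewrite -natr1 /frac; lra.
pose w theta k := Num.truncn (h k + (1 - theta)).
have wsum k : (k <= r + m)%N -> \sum_(q <- l) q.1 * (w q.2 k)%:R = h k.
  move=> kn; have /andP[h0 _] := hLU k kn.
  have {}h0 : 0 <= h k by apply: le_trans h0.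
  transitivity (\sum_(q <- l) (q.1 * (Num.truncn (h k))%:R +
                               q.1 * (q.2 <= frac (h k))%R%:R)).
    apply: eq_big_seq => q /lP[_ q2].
    by rewrite /w truncn_round// natrD mulrDr.
  rewrite big_split /= -mulr_suml l1 mul1r lsum; first by rewrite addrC subrK.
  by apply/mapP; exists (inord k); rewrite ?mem_enum// inordK.
have -> : step_vector p =
    \sum_(q <- l) q.1 *: \row_(i < r + m) ((w q.2 i.+1)%:R - (w q.2 i)%:R).
  apply/rowP => i; rewrite summxE mxE !hE lift_max lift0.
  rewrite -(wsum i.+1)// -(wsum i (ltnW (ltn_ord i))) -sumrB.
  by apply: eq_bigr => q _; rewrite !mxE mulrBr.
apply: convex_sum => // [q /lP[]//|q /lP[_ q2]].
have [P PE] := rounded_path q2 hLU hS.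
have -> : \row_i ((w q.2 i.+1)%:R - (w q.2 i)%:R) =
    \row_i (P i)%:R :> 'rV[R]_(r + m).
  apply/rowP => i; rewrite !mxE /w.
  have [<- _] := PE i.+1 (ltn_ord i); have [<- _] := PE i (ltnW (ltn_ord i)).
  by rewrite yposS natrD addrC addKr.
by apply: CP; apply/never_aboveP => k /PE[_ /andP[]].
Qed.

End Rounding.

Theorem theorem3p4 (R : realType) (m r : nat) (U L : lattice_path m r)
    (LU : never_above L U) :
  basis_polytope (lpm LU) = gen_step_vectors U L :> set 'rV[R]_(r + m).
Proof.
apply/seteqP; split.
  apply: smallest_sub; first exact: convex_gen_step_vectors.
  move=> _ [B /imsetP[P /[!inE] /andP[PU PL] ->] ->].
  by rewrite basis_vectorE; apply: path_gen_step_vectors.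
(* Membership in the hull is tested against each convex [C] containing the basis vectors. *)
move=> _ [p gp <-] C [cC BC].
apply: step_vector_in_convex cC _ gp => P PU PL; apply: BC.
by exists (step_set P); rewrite -?basis_vectorE// imset_f// inE PU.
Qed.
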